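(* There exist universal constants $C, c_1, c_2 > 0$ such that the following holds. Fix reals $L \ge \alpha > 0$, $\delta \in (0, \frac{1}{2}]$ and $\varepsilon \in (0,1]$. There are boolean functions $f_1, f_2, \ldots$, with $f_k : \{0,1\}^{n_k} \to \{0,1\}$, such that for all sufficiently large $k$ (how large may depend on $\alpha, L, \delta, \varepsilon$) and for every $\delta$-balanced product distribution $\mathcal{D}$ over $\{0,1\}^{n_k}$: (1) $f_k$ is $\varepsilon$-close, with respect to $\mathcal{D}$, to an $r$-junta for some $r \le C k/\delta$; (2) for every $(\alpha, L)$-impurity function $\mathscr{G}$, any $\mathscr{G}$-impurity-based decision tree learning algorithm, when learning $f_k$ on $\mathcal{D}$, returns a decision tree $T$ that either has depth at least $c_1\, \varepsilon\, 2^k$ or has error $\Pr_{x \sim \mathcal{D}}[T(x) \ne f_k(x)] \ge c_2$.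
   Context: **Juntas and closeness.** A function $g : \{0,1\}^n \to \{0,1\}$ is an $r$-junta if it depends on at most $r$ of its input coordinates. $f$ is $\varepsilon$-close to $g$ with respect to $\mathcal{D}$ if $\Pr_{x\sim\mathcal{D}}[f(x) \ne g(x)] \le \varepsilon$. **Impurity functions.** An impurity function is a concave function $\mathscr{G} : [0,1] \to [0,1]$ that is symmetric around $\frac12$ and satisfies $\mathscr{G}(0) = \mathscr{G}(1) = 0$ and $\mathscr{G}(\frac12) = 1$. It is an $(\alpha, L)$-impurity function if moreover it is twice differentiable and $\mathscr{G}''(t) \in [-L, -\alpha]$ for every $t \in [0,1]$. **Balanced distributions.** A product distribution over $\{0,1\}^n$ is $\delta$-balanced if the expectation of each of the $n$ coordinates lies in $[\delta, 1-\delta]$. **Restrictions.** A restriction $\pi$ is a list of constraints of the form ''$x_i = b$'' in which every index $i$ appears at most once. For $f : \{0,1\}^n \to \{0,1\}$, the restricted function $f_\pi : \{0,1\}^n \to \{0,1\}$ is $f_\pi(x) = f(x')$, where $x'$ is obtained from $x$ by overwriting the coordinates in $\pi$ with the prescribed values; in particular $f_{x_i = b}(x)$ is $f$ evaluated at $x$ with the $i$-th bit set to $b$. **Purity gain.** For a distribution $\mathcal{D}$ over $\{0,1\}^n$ with $p_i = \Pr_{x \sim \mathcal{D}}[x_i = 1]$, $$\mathscr{G}\text{-purity-gain}_{\mathcal{D}}(f, x_i) := \mathscr{G}\big(\mathbb{E}_{x\sim\mathcal{D}}[f(x)]\big) - p_i\, \mathscr{G}\big(\mathbb{E}_{x\sim\mathcal{D}}[f_{x_i=1}(x)]\big)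 - (1-p_i)\, \mathscr{G}\big(\mathbb{E}_{x\sim\mathcal{D}}[f_{x_i=0}(x)]\big).$$ **Impurity-based algorithms.** Decision trees query a single variable at each internal node and have leaves labeled by bits; depth is the maximum number of queries on a root-to-leaf path. Each node $v$ corresponds to the restriction $\pi_v$ formed by the queries (and their answers) at the proper ancestors of $v$, and $f_v := f_{\pi_v}$. A decision tree learning algorithm (which, given $f : \{0,1\}^n\to\{0,1\}$ and a distribution $\mathcal{D}$ over $\{0,1\}^n$, outputs a decision tree) is $\mathscr{G}$-impurity-based if for every $f$ and $\mathcal{D}$, in the tree it outputs when learning $f$ on $\mathcal{D}$, for every internal node $v$ the variable $x_i$ queried at $v$ satisfies $\mathscr{G}\text{-purity-gain}_{\mathcal{D}}(f_v, x_i) \ge \mathscr{G}\text{-purity-gain}_{\mathcal{D}}(f_v, x_j)$ for every $j \in [n]$. *)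

(* Defs.v *)
From HB Require Import structures.
From mathcomp Require Import all_boot all_order all_algebra.
From mathcomp Require Import all_classical all_reals all_analysis.

Set Implicit Arguments.
Unset Strict Implicit.
Unset Printing Implicit Defensive.

Import Order.TTheory GRing.Theory Num.Theory.
Import numFieldNormedType.Exports.

Local Open Scope classical_set_scope.
Local Open Scope ring_scope.

Definition cube (n : nat) := {ffun 'I_n -> bool}.

Definition boolfun (n : nat) := cube n -> bool.

Record dist (R : realType) (n : nat) := Dist {
  pmf :> cube n -> R;
  pmf_ge0 : forall x, 0 <= pmf x;
  pmf_sum1 : \sum_x pmf x = 1 }.

Definition Prob (R : realType) n (D : dist R n) (E : pred (cube n)) : R :=
  \sum_(x | E x) D x.

Definition Expect (R : realType) n (D : dist R n) (h : cube n -> R) : R :=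
  \sum_x D x * h x.

Definition mean (R : realType) n (D : dist R n) (f : boolfun n) : R :=
  Expect D (fun x => (f x)%:R).

Definition product_dist (R : realType) n (D : dist R n) : Prop :=
  forall x, D x = \prod_(i < n) Prob D (fun y => y i == x i).

Definition balanced_product (R : realType) n (delta : R) (D : dist R n) : Prop :=
  product_dist D /\
  forall i : 'I_n, delta <= Expect D (fun x => (x i)%:R) <= 1 - delta.

(* A partial assignment represents a list of constraints [x_i = b] in which
   every index appears at most once, up to the order of the constraints. *)
Definition restriction (n : nat) := {ffun 'I_n -> option bool}.

Definition no_constraint n : restriction n := [ffun => None].

(* An index that is already constrained keeps its constraint. *)
Definition add_constraint n (pi : restriction n) (i : 'I_n) (b : bool) :
    restriction n :=
  [ffun j => if (j == i) && (pi j == None) then Some b else pi j].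

Definition overwrite n (pi : restriction n) (x : cube n) : cube n :=
  [ffun i => odflt (x i) (pi i)].

Definition restrict_by n (f : boolfun n) (pi : restriction n) : boolfun n :=
  fun x => f (overwrite pi x).

Definition restrict1 n (f : boolfun n) (i : 'I_n) (b : bool) : boolfun n :=
  restrict_by f (add_constraint (no_constraint n) i b).

Definition depends_on n (g : boolfun n) (i : 'I_n) : bool :=
  [exists x, restrict1 g i false x != restrict1 g i true x].

Definition junta n (r : nat) (g : boolfun n) : Prop :=
  (#|[set i | depends_on g i]%SET| <= r)%N.

Definition eps_close (R : realType) n (eps : R) (D : dist R n) (f g : boolfun n) :
    Prop :=
  Prob D (fun x => f x != g x) <= eps.

(* Functions on [0, 1] are represented by functions R -> R, whose values outside
   [0, 1] are unconstrained; hence every condition below, including the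
   derivatives, is relative to [0, 1] (one-sided at 0 and at 1). *)
Definition impurity (R : realType) (G : R -> R) : Prop :=
  [/\ forall t, 0 <= t <= 1 -> 0 <= G t <= 1,
      convex_function (`[0, 1]%classic : set R) (fun t => - G t),
      forall t, 0 <= t <= 1 -> G (1 - t) = G t,
      G 0 = 0 /\ G 1 = 0
    & G 2^-1 = 1].

Definition is_derivative01 (R : realType) (g dg : R -> R) : Prop :=
  forall t : R, 0 <= t <= 1 ->
    (g s - g t) / (s - t) @[s --> within `[0, 1]%classic t^'] --> dg t.

Definition ab_impurity (R : realType) (alpha L : R) (G : R -> R) : Prop :=
  impurity G /\
  exists G1 G2 : R -> R,
    [/\ is_derivative01 G G1, is_derivative01 G1 G2
      & forall t, 0 <= t <= 1 -> - L <= G2 t <= - alpha].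

Definition purity_gain (R : realType) (G : R -> R) n (D : dist R n)
    (f : boolfun n) (i : 'I_n) : R :=
  let p := Prob D (fun x => x i) in
  G (mean D f) - p * G (mean D (restrict1 f i true))
               - (1 - p) * G (mean D (restrict1 f i false)).

(* [TreeNode i T0 T1] queries x_i and continues in T0 if x_i = 0, in T1 if x_i = 1. *)
Inductive dtree (n : nat) : Type :=
| TreeLeaf of bool
| TreeNode of 'I_n & dtree n & dtree n.

Fixpoint tree_eval n (T : dtree n) (x : cube n) : bool :=
  match T with
  | TreeLeaf b => b
  | TreeNode i T0 T1 => if x i then tree_eval T1 x else tree_eval T0 x
  end.

Fixpoint tree_depth n (T : dtree n) : nat :=
  match T with
  | TreeLeaf _ => 0%N
  | TreeNode _ T0 T1 => (maxn (tree_depth T0) (tree_depth T1)).+1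
  end.

(* The pairs (pi_v, i_v), with x_{i_v} the variable queried at v, for the
   internal nodes v of a tree T whose root corresponds to the restriction pi. *)
Fixpoint internal_nodes n (pi : restriction n) (T : dtree n) :
    seq (restriction n * 'I_n) :=
  match T with
  | TreeLeaf _ => [::]
  | TreeNode i T0 T1 =>
      (pi, i) :: internal_nodes (add_constraint pi i false) T0
              ++ internal_nodes (add_constraint pi i true) T1
  end.

Definition learner (R : realType) :=
  forall n : nat, boolfun n -> dist R n -> dtree n.

Definition impurity_based (R : realType) (G : R -> R) (A : learner R) : Prop :=
  forall n (f : boolfun n) (D : dist R n) (v : restriction n * 'I_n),
    v \in internal_nodes (no_constraint n) (A n f D) ->
    forall j : 'I_n,
      purity_gain G D (restrict_by f v.1) j <= purity_gain G D (restrict_by f v.1) v.2.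

Definition tree_error (R : realType) n (D : dist R n) (T : dtree n) (f : boolfun n) :
    R :=
  Prob D (fun x => tree_eval T x != f x).

(* Main.v *)
Require Import Defs.
From mathcomp Require Import all_boot all_order all_algebra.
From mathcomp Require Import all_classical all_reals all_analysis.
From mathcomp Require Import ring lra.

(* Take disjoint blocks of m = O(k / delta) variables, and 2^k further
   variables y_a.  Under a delta-balanced product distribution the parity of a
   block has bias at most (1 - 2 delta)^m, hence is an almost fair coin
   whatever the distribution is.  The function f_k is the parity of one block,
   unless the parities of w = O(log (1 / eps)) other blocks are all 1, in which
   case it is y_a, where the address a is read off the parities of k more
   blocks.  As long as only y-variables have been queried, fixing a block
   variable moves the mean by at most (1 - 2 delta)^(m - 1) <= 9^-k, whereas
   fixing an unqueried y_a moves it by the probability of selecting a, at least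
   3^-(w + k).  Since G'' lies in [-L, -alpha], the purity gain is
   comparable to the square of that move, so some y-variable is always
   preferred until all 2^k of them have been queried.  A shallower tree depends
   on y-variables only, and is therefore almost uncorrelated with the parity
   that f_k equals most of the time. *)

Set Implicit Arguments.
Unset Strict Implicit.
Unset Printing Implicit Defensive.

Import Order.TTheory GRing.Theory Num.Theory.
Import numFieldNormedType.Exports.
Local Open Scope ring_scope.

(** * Purity gains of strongly concave impurities *)

Section MeanValue.
Local Open Scope classical_set_scope.
Local Open Scope ring_scope.
Variables (R : realType) (g dg : R -> R).
Hypothesis gd : is_derivative01 g dg.

(** At an interior point small increments stay inside [0, 1], so the relative derivative is an
    ordinary one, as the mean value theorem requires. *)
Lemma derivative01_is_derive (t : R) : 0 < t < 1 -> is_derive t 1 g (dg t).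
Proof.
move=> /andP[t0 t1].
have ht : 0 <= t <= 1 by lra.
have cv : (h^-1 *: (g (h *: 1 + t) - g t)) @[h --> (0 : R)^'] --> dg t.
  apply/cvgrPdist_lt => e e0.
  have /cvgrPdist_lt /(_ e e0) := gd ht.
  rewrite {1}/within/= {1}/dnbhs /within/= => /nbhs_ballP[d /= d0 H].
  near=> h.
  have h0 : h != 0 by near: h; exact: nbhs_dnbhs_neq.
  have hd : `|h| < Num.min d (Num.min t (1 - t)).
    near: h; apply: dnbhs0_lt.
    by rewrite !lt_min d0 t0 subr_gt0.
  move: hd; rewrite !lt_min => /and3P[hd + +].
  rewrite !(ltr_norml h) => ht1 ht2.
  have := H (h + t).
  rewrite /ball /= opprD addrCA subrr addr0 normrN => /(_ hd).
  rewrite -subr_eq0 addrK => /(_ h0).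
  rewrite in_itv /= => H'.
  have {}H' := H' ltac:(lra).
  by rewrite [_ *: (1:R)]mulr1 [_ *: (_ - _)]mulrC.
apply: DeriveDef; first by apply/cvg_ex; exists (dg t); exact: cv.
by apply/cvg_lim => //; exact: cv.
Unshelve. all: by end_near. Qed.

(** Near [t] the difference quotient stays below [|dg t| + 1] in absolute value. This argument also
    covers the endpoints 0 and 1. *)
Lemma derivative01_continuous (u v : R) : 0 <= u -> v <= 1 ->
  {within `[u, v]%classic, continuous g}.
Proof.
move=> u0 v1; apply/subspace_continuousP => t /=; rewrite in_itv /= => /andP[ut tv].
have ht : 0 <= t <= 1 by lra.
apply/cvgrPdist_lt => e e0.
have /cvgrPdist_lt /(_ 1 ltr01) := gd ht.
rewrite /within/= /dnbhs /within/= => /nbhs_ballP[d /= d0 H].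
set M : R := `|dg t| + 1.
have M0 : 0 < M by rewrite ltr_wpDl.
apply/nbhs_ballP; exists (Num.min d (e / M)).
  by rewrite /= lt_min d0 divr_gt0.
move=> s; rewrite /ball /= lt_min => /andP[sd se]; rewrite in_itv /= => /andP[us sv].
have [->|st] := eqVneq s t; first by rewrite subrr normr0.
have := H s sd st; rewrite in_itv /= => /(_ ltac:(lra)) => hq.
have st0 : 0 < `|s - t| by rewrite normr_gt0 subr_eq0.
have hq2 : `|(g s - g t) / (s - t)| < M.
  rewrite (_ : _ / _ = dg t - (dg t - (g s - g t) / (s - t))); last by ring.
  by apply: (le_lt_trans (ler_normB _ _)); rewrite ltrD2l.
rewrite distrC.
rewrite normrM normfV ltr_pdivrMr // in hq2.
apply: (lt_trans hq2).
by rewrite mulrC -ltr_pdivlMr // distrC.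
Qed.

Lemma derivative01_MVT (u v : R) : 0 <= u -> u < v -> v <= 1 ->
  exists2 c, u < c < v & g v - g u = dg c * (v - u).
Proof.
move=> u0 uv v1.
have dg_uv x : x \in `]u, v[%R -> is_derive x 1 g (dg x).
  by rewrite in_itv /= => xuv; apply: derivative01_is_derive; lra.
have [c] := MVT uv dg_uv (derivative01_continuous u0 v1).
by rewrite in_itv /= => cuv ?; exists c.
Qed.

End MeanValue.

Section PurityGainBounds.
Variables (R : realType) (alpha L : R) (G : R -> R).
Hypotheses (alpha0 : 0 < alpha) (Gab : ab_impurity alpha L G).

(** With [a] the mean of [u] and [v], the mean value theorem on both sides of [a] turns the gap into
    [p * (1 - p) * (v - u) * (G1 c1 - G1 c2)]; applied to [G1], it bounds the last factor by
    [L * (v - u)]. *)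
Lemma impurity_gap_le (p u v : R) : 0 <= p <= 1 -> 0 <= u <= 1 -> 0 <= v <= 1 ->
  G (p * u + (1 - p) * v) - p * G u - (1 - p) * G v <= L * (u - v) ^+ 2.
Proof.
case: Gab => _ [G1 [G2 [dG dG1 hG2]]].
wlog uv : p u v / u < v => [wl|].
  move=> hp hu hv; case: (ltgtP u v) => [|vu|->]; first by move/wl; exact.
  - have := wl (1 - p) v u vu ltac:(lra) hv hu.
    by rewrite (_ : 1 - (1 - p) = p) ?[_ * v + _]addrC; [lra|ring].
  - by rewrite (_ : p * v + (1 - p) * v = v) ?subrr ?expr0n ?mulr0; [lra|ring].
move=> hp /andP[u0 u1] /andP[v0 v1].
have L0 : 0 < L by have := hG2 u ltac:(lra); move: alpha0; lra.
set a := p * u + (1 - p) * v.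
have au : a - u = (1 - p) * (v - u) by rewrite /a; ring.
have va : v - a = p * (v - u) by rewrite /a; ring.
(* For [p] equal to 0 or 1 the point [a] is an endpoint and the gap vanishes. *)
have [p0|p0] := eqVneq p 0.
  rewrite /a p0 !mul0r add0r !subr0 !mul1r subrr.
  by rewrite mulr_ge0 ?sqr_ge0 // ltW.
have [p1|p1] := eqVneq p 1.
  rewrite /a p1 subrr !mul0r addr0 !mul1r subr0 subrr.
  by rewrite mulr_ge0 ?sqr_ge0 // ltW.
have p0' : 0 < p by lra.
have p1' : p < 1 by lra.
have ua' : u < a by rewrite -subr_gt0 au mulr_gt0; lra.
have av' : a < v by rewrite -subr_gt0 va mulr_gt0; lra.
have [c1 hc1 E1] := derivative01_MVT dG u0 ua' ltac:(lra).
have [c2 hc2 E2] := derivative01_MVT dG (ltac:(lra) : 0 <= a) av' v1.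
have [c3 hc3 E3] := derivative01_MVT dG1
  (ltac:(lra) : 0 <= c1) (ltac:(lra) : c1 < c2) (ltac:(lra) : c2 <= 1).
have -> : G a - p * G u - (1 - p) * G v = p * (1 - p) * (v - u) * (G1 c1 - G1 c2).
  by rewrite (_ : _ - _ = p * (G a - G u) - (1 - p) * (G v - G a));
    [rewrite E1 E2 au va|]; ring.
have hc : G1 c1 - G1 c2 <= L * (v - u).
  rewrite -opprB E3 -mulNr.
  have hL := hG2 c3 ltac:(lra).
  apply: (@le_trans _ _ (L * (c2 - c1))); first by rewrite ler_wpM2r; lra.
  by rewrite ler_wpM2l; lra.
have hpp : p * (1 - p) <= 1 by rewrite mulr_ile1; lra.
have hpp0 : 0 <= p * (1 - p) by rewrite mulr_ge0; lra.
apply: (@le_trans _ _ (p * (1 - p) * (v - u) * (L * (v - u)))).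
  by rewrite ler_wpM2l // mulr_ge0 //; lra.
rewrite (_ : _ * _ = (p * (1 - p)) * (L * (u - v) ^+ 2)); last by ring.
by rewrite -[leRHS]mul1r ler_wpM2r // mulr_ge0 ?sqr_ge0 // ltW.
Qed.

(** Compare [G] with its tangent at [a]: on the right of [a] it lies below, and on the left the half
    of [u, a] farther from [a] contributes a quadratic surplus. Splitting at the midpoint keeps the
    intermediate point away from [a]. *)
Lemma impurity_gap_ge (delta p u v : R) : 0 < delta -> delta <= p <= 1 - delta ->
    0 <= u <= 1 -> 0 <= v <= 1 ->
  alpha * delta ^+ 3 / 4 * (u - v) ^+ 2
    <= G (p * u + (1 - p) * v) - p * G u - (1 - p) * G v.
Proof.
move=> d0; case: Gab => _ [G1 [G2 [dG dG1 hG2]]].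
wlog uv : p u v / u < v => [wl|].
  move=> hp hu hv; case: (ltgtP u v) => [|vu|->]; first by move/wl; exact.
  - have := wl (1 - p) v u vu ltac:(lra) hv hu.
    rewrite -(sqrrN (v - u)) opprB.
    by rewrite (_ : 1 - (1 - p) = p) ?[_ * v + _]addrC; [lra|ring].
  - by rewrite (_ : p * v + (1 - p) * v = v) ?subrr ?expr0n ?mulr0; [lra|ring].
move=> /andP[dp pd].
have dp3 : delta * delta ^+ 2 <= p * (1 - p) ^+ 2.
  by apply: ler_pM; rewrite ?sqr_ge0 ?lerXn2r ?nnegrE //; lra.
move=> /andP[u0 u1] /andP[v0 v1].
set a := p * u + (1 - p) * v.
have au : a - u = (1 - p) * (v - u) by rewrite /a; ring.
have va : v - a = p * (v - u) by rewrite /a; ring.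
have ua' : u < a by rewrite -subr_gt0 au mulr_gt0; lra.
have av' : a < v by rewrite -subr_gt0 va mulr_gt0; lra.
move: (alpha0) => ?.
have dG1_lt x y : 0 <= x -> x < y -> y <= 1 -> alpha * (y - x) <= G1 x - G1 y.
  move=> x0 xy y1; have [c hc E] := derivative01_MVT dG1 x0 xy y1.
  have hL := hG2 c ltac:(lra).
  by rewrite -(opprB (G1 y)) E -mulNr ler_wpM2r; lra.
(* The slope of [G] on [u, m] exceeds its slope at [a] by [alpha * (a - m)]. *)
pose m := (u + a) / 2.
have [c1 hc1 E1] := derivative01_MVT dG u0
  (ltac:(rewrite /m; lra) : u < m) (ltac:(rewrite /m; lra) : m <= 1).
have [c2 hc2 E2] := derivative01_MVT dG
  (ltac:(rewrite /m; lra) : 0 <= m) (ltac:(rewrite /m; lra) : m < a)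
  (ltac:(lra) : a <= 1).
have [c3 hc3 E3] := derivative01_MVT dG (ltac:(lra) : 0 <= a) av' v1.
have m0 : u < m by rewrite /m; lra.
have m1 : m < a by rewrite /m; lra.
have ma : a - m = (a - u) / 2 by rewrite /m; lra.
have mu : m - u = (a - u) / 2 by rewrite /m; lra.
have h2 : G1 a <= G1 c2.
  have := dG1_lt c2 a ltac:(lra) ltac:(lra) ltac:(lra).
  have : 0 <= alpha * (a - c2) by rewrite mulr_ge0; lra.
  by lra.
have h3 : G1 c3 <= G1 a.
  have := dG1_lt a c3 ltac:(lra) ltac:(lra) ltac:(lra).
  have : 0 <= alpha * (c3 - a) by rewrite mulr_ge0; lra.
  by lra.
have h1 : G1 a + alpha * ((a - u) / 2) <= G1 c1.
  have := dG1_lt c1 a ltac:(lra) ltac:(lra) ltac:(lra).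
  have : alpha * ((a - u) / 2) <= alpha * (a - c1) by rewrite ler_wpM2l; lra.
  by lra.
have k1 : (G1 a + alpha * ((a - u) / 2)) * ((a - u) / 2) <= G m - G u.
  by rewrite E1 mu ler_wpM2r; lra.
have k2 : G1 a * ((a - u) / 2) <= G a - G m by rewrite E2 ma ler_wpM2r; lra.
have k3 : G v - G a <= G1 a * (v - a) by rewrite E3 ler_wpM2r; lra.
have K : alpha * (a - u) ^+ 2 / 4 + G1 a * (a - u) <= G a - G u.
  by rewrite (_ : _ + _ = (G1 a + alpha * ((a - u) / 2)) * ((a - u) / 2)
     + G1 a * ((a - u) / 2)); [lra|field].
have K1 : p * (alpha * (a - u) ^+ 2 / 4 + G1 a * (a - u)) <= p * (G a - G u).
  by rewrite ler_wpM2l; lra.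
have K3 : (1 - p) * (G v - G a) <= (1 - p) * (G1 a * (v - a)).
  by rewrite ler_wpM2l; lra.
(* The terms in [G1 a] cancel because [p * (a - u) = (1 - p) * (v - a)]. *)
have : p * (alpha * (a - u) ^+ 2 / 4) <= G a - p * G u - (1 - p) * G v.
  rewrite -subr_ge0 in K1; rewrite -subr_ge0 in K3; rewrite -subr_ge0.
  rewrite (_ : _ - _ = p * (G a - G u) - p * (alpha * (a - u) ^+ 2 / 4 + G1 a * (a - u))
    + ((1 - p) * (G1 a * (v - a)) - (1 - p) * (G v - G a))); first exact: addr_ge0.
  by rewrite au va; ring.
apply: le_trans; rewrite au.
rewrite (_ : p * _ = alpha / 4 * (u - v) ^+ 2 * (p * (1 - p) ^+ 2)); last by field.
rewrite (_ : _ * _ = alpha / 4 * (u - v) ^+ 2 * (delta * delta ^+ 2)); last by field.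
by rewrite ler_wpM2l // mulr_ge0 ?sqr_ge0 // divr_ge0 // ltW.
Qed.

End PurityGainBounds.

(** * Product distributions and parities *)

Definition depends_only n (A : Type) (S : {set 'I_n}) (h : cube n -> A) :=
  forall x y : cube n, {in S, x =1 y} -> h x = h y.

Definition mix n (S : {set 'I_n}) (x y : cube n) : cube n :=
  [ffun i => if i \in S then x i else y i].

Definition upd n (x : cube n) (i : 'I_n) (b : bool) : cube n :=
  [ffun j => if j == i then b else x j].

Definition par n (S : {set 'I_n}) (x : cube n) : bool :=
  \big[addb/false]_(i in S) x i.

Lemma restrict1E n (f : boolfun n) i b x : restrict1 f i b x = f (upd x i b).
Proof.
congr f; apply/ffunP => j; rewrite !ffunE.
by rewrite eqxx andbT; case: (j == i).
Qed.

Lemma par_depends_only n (S : {set 'I_n}) : depends_only S (par S).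
Proof. by move=> x y e; apply: eq_bigr => i /e. Qed.

Lemma parD1 n (S : {set 'I_n}) i x : i \in S ->
  par S x = x i (+) par (S :\ i) x.
Proof.
move=> iS; rewrite /par (bigD1 i) //=; congr (_ (+) _).
by apply: eq_bigl => j; rewrite in_setD1 andbC.
Qed.

Lemma par_upd n (S : {set 'I_n}) i b x : i \in S ->
  par S (upd x i b) = b (+) par (S :\ i) x.
Proof.
move=> iS; rewrite (parD1 _ iS) ffunE eqxx; congr (_ (+) _).
by apply: par_depends_only => j; rewrite in_setD1 ffunE => /andP[/negPf->].
Qed.

Lemma par_junta n (S : {set 'I_n}) : junta #|S| (par S).
Proof.
apply/subset_leq_card/fintype.subsetP => i; rewrite inE => /existsP[x].
apply: contraR => iS; rewrite !restrict1E; apply/eqP.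
apply: par_depends_only => j jS; rewrite !ffunE; case: eqVneq => // ji.
by rewrite -ji jS in iS.
Qed.

Section Expectation.
Variables (R : realType) (n : nat) (D : dist R n).
Implicit Types (h g : cube n -> R) (f : boolfun n) (S : {set 'I_n}).

Lemma ProbE (P : pred (cube n)) : Prob D P = Expect D (fun x => (P x)%:R).
Proof.
rewrite /Prob /Expect big_mkcond; apply: eq_bigr => x _.
by case: (P x); rewrite ?mulr1 ?mulr0.
Qed.

Lemma eq_Expect h g : h =1 g -> Expect D h = Expect D g.
Proof. by move=> e; apply: eq_bigr => x _; rewrite e. Qed.

Lemma ExpectD h g : Expect D (fun x => h x + g x) = Expect D h + Expect D g.
Proof. by rewrite /Expect -big_split; apply: eq_bigr => x _; rewrite mulrDr. Qed.

Lemma ExpectZ c h : Expect D (fun x => c * h x) = c * Expect D h.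
Proof. by rewrite /Expect mulr_sumr; apply: eq_bigr => x _; rewrite mulrCA. Qed.

Lemma ExpectB h g : Expect D (fun x => h x - g x) = Expect D h - Expect D g.
Proof.
rewrite -mulN1r -ExpectZ -ExpectD.
by apply: eq_Expect => x; rewrite mulN1r.
Qed.

Lemma Expect_cst c : Expect D (fun=> c) = c.
Proof. by rewrite /Expect -mulr_suml pmf_sum1 mul1r. Qed.

Lemma ler_Expect h g : (forall x, h x <= g x) -> Expect D h <= Expect D g.
Proof. by move=> hg; apply: ler_sum => x _; rewrite ler_wpM2l ?Defs.pmf_ge0 ?hg. Qed.

Lemma ler_norm_Expect h c : (forall x, `|h x| <= c) -> `|Expect D h| <= c.
Proof.
move=> hc; rewrite ler_norml -[- c]Expect_cst -[X in _ && (_ <= X)]Expect_cst.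
by apply/andP; split; apply: ler_Expect => x; have := hc x; rewrite ler_norml => /andP[].
Qed.

Lemma Prob01 P : 0 <= Prob D P <= 1.
Proof.
rewrite ProbE -[X in X <= _]Expect_cst -[X in _ && (_ <= X)]Expect_cst.
by rewrite !ler_Expect // => x; case: (P x); rewrite ?ler01 ?lexx.
Qed.

Lemma mean01 f : 0 <= mean D f <= 1.
Proof. by rewrite /mean -ProbE Prob01. Qed.

Hypothesis prodD : product_dist D.

(* Exchanging the S-coordinates of two independent samples preserves their
   joint law, and turns [h x * g y] into [h x * g x]. *)
Lemma Expect_indep S h g : depends_only S h -> depends_only (~: S) g ->
  Expect D (fun x => h x * g x) = Expect D h * Expect D g.
Proof.
move=> hS gS.
have -> : Expect D h * Expect D g =
    \sum_(z : cube n * cube n) D z.1 * D z.2 * (h z.1 * g z.2).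
  rewrite /Expect big_distrlr pair_big /=; apply: eq_bigr => z _.
  by rewrite mulrACA.
pose sw (z : cube n * cube n) := (mix S z.1 z.2, mix S z.2 z.1).
have swK : involutive sw.
  by move=> [x y]; rewrite /sw /=; congr pair; apply/ffunP => i; rewrite !ffunE;
    case: (i \in S).
rewrite (reindex_inj (inv_inj swK)) /=.
transitivity (\sum_(z : cube n * cube n) D z.1 * D z.2 * (h z.1 * g z.1)).
  rewrite -(pair_bigA _ (fun x y => D x * D y * (h x * g x))) /=.
  apply: eq_bigr => x _; rewrite -big_distrl -big_distrr /=.
  by rewrite pmf_sum1 mulr1.
apply: eq_bigr => -[x y] _ /=; congr (_ * _).
  rewrite !(prodD (mix _ _ _)) (prodD x) (prodD y) -!big_split /=.
  by apply: eq_bigr => i _; rewrite !ffunE; case: ifP => // _; rewrite mulrC.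
congr (_ * _); first by apply: hS => i iS; rewrite ffunE iS.
by apply: gS => i; rewrite inE ffunE => /negPf->.
Qed.

Lemma Expect_prod (J : eqType) (r : seq J) (B : J -> {set 'I_n})
    (h : J -> cube n -> R) :
    uniq r -> (forall s t, s != t -> [disjoint B s & B t]) ->
    (forall t, depends_only (B t) (h t)) ->
  Expect D (fun x => \prod_(t <- r) h t x) = \prod_(t <- r) Expect D (h t).
Proof.
move=> + dB hB; elim: r => [_|t r IH /= /andP[tr ur]].
  by rewrite big_nil -[RHS]Expect_cst; apply: eq_Expect => x; rewrite big_nil.
rewrite big_cons -IH // -(@Expect_indep (B t)) //.
  by apply: eq_Expect => x; rewrite big_cons.
move=> x y e; rewrite !big_seq; apply: eq_bigr => s sr; apply: hB => i iB.
apply: e; rewrite inE; apply/negP => iBt.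
have st : s != t by apply: contraNneq tr => <-.
by have /pred0P/(_ i) := dB _ _ st; rewrite /= iB iBt.
Qed.

(** The sign of a parity is the product of the signs of its bits, which are independent. *)
Lemma Expect_sign_par S :
  Expect D (fun x => (-1) ^+ par S x)
  = \prod_(i in S) (1 - 2 * Expect D (fun x => (x i)%:R)).
Proof.
have signE x : (-1) ^+ par S x = \prod_(i <- enum S) (-1) ^+ (x i) :> R.
  rewrite big_enum /= /par.
  by apply: (big_morph (fun b : bool => (-1) ^+ b : R)) => // a b; rewrite signr_addb.
rewrite (eq_Expect signE) (@Expect_prod _ _ (fun i => [set i]%SET)) ?enum_uniq //.
- rewrite big_enum; apply: eq_bigr => i _.
  rewrite -[X in _ = X - _]Expect_cst -ExpectZ -ExpectB; apply: eq_Expect => x.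
  by case: (x i); rewrite /= ?expr1 ?expr0; ring.
- by move=> s t st; rewrite disjoints1 inE.
- by move=> t x y e; rewrite e ?inE.
Qed.

(** The restricted functions ignore [x i], hence are independent of it. This puts the purity gain in
    the form to which the gap bounds apply. *)
Lemma mean_restrict1 f i :
  mean D f = Prob D (fun x => x i) * mean D (restrict1 f i true)
    + (1 - Prob D (fun x => x i)) * mean D (restrict1 f i false).
Proof.
have dep b : depends_only (~: [set i]) (fun x => (restrict1 f i b x)%:R : R).
  move=> x y e; rewrite !restrict1E; congr (nat_of_bool (f _))%:R.
  apply/ffunP => j; rewrite !ffunE; case: eqVneq => // ji.
  by apply: e; rewrite !inE.
have depi (u : bool -> R) : depends_only [set i]%SET (fun x : cube n => u (x i)).
  by move=> x y e; rewrite e ?inE.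
rewrite ProbE -[X in _ + (X - _) * _]Expect_cst -ExpectB /mean.
rewrite -(Expect_indep (depi (fun b => b%:R)) (dep true)).
rewrite -(Expect_indep (depi (fun b => 1 - b%:R)) (dep false)) -ExpectD.
apply: eq_Expect => x; rewrite !restrict1E.
have updx : upd x i (x i) = x.
  by apply/ffunP => j; rewrite ffunE; case: eqVneq => // ->.
by rewrite -{1}updx; case: (x i) => /=; ring.
Qed.

End Expectation.

(** * Parities under balanced product distributions *)

Section Balanced.
Variables (R : realType) (n : nat) (D : dist R n) (delta : R).
Hypothesis balD : balanced_product delta D.
Implicit Types (f g : boolfun n) (S : {set 'I_n}).

Let prodD : product_dist D. Proof. by case: balD. Qed.

Lemma par_bias S :
  `|Expect D (fun x => (-1) ^+ par S x)| <= (1 - 2 * delta) ^+ #|S|.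
Proof.
rewrite Expect_sign_par // normr_prod -prodr_const; apply: ler_prod => i _.
rewrite normr_ge0 /= ler_norml.
by have [_ /(_ i)] := balD; lra.
Qed.

Lemma mean_par S b :
  `|Prob D (fun x => par S x == b) - 2^-1| <= (1 - 2 * delta) ^+ #|S| / 2.
Proof.
have -> : Prob D (fun x => par S x == b) - 2^-1 =
    (-1) ^+ b * 2^-1 * Expect D (fun x => (-1) ^+ par S x).
  rewrite ProbE -(Expect_cst D 2^-1) -ExpectB Expect_cst -ExpectZ.
  apply: eq_Expect => x.
  by case: (par S x); case: b; rewrite /= ?expr1 ?expr0; field.
rewrite !normrM normr_sign mul1r ger0_norm ?invr_ge0 // mulrC.
by rewrite ler_wpM2r ?invr_ge0 ?par_bias.
Qed.

(** When [g] sees [S] only through its parity, flipping [i] changes [g] by a quantity [d] living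
    outside [S], up to the sign given by the parity of [S :\ i]. By independence the bias of that
    parity factors out. *)
Lemma restrict1_par_diff g S i : i \in S ->
    (forall x y : cube n, {in (~: S), x =1 y} -> par S x = par S y -> g x = g y) ->
  `|mean D (restrict1 g i true) - mean D (restrict1 g i false)|
    <= (1 - 2 * delta) ^+ #|S|.-1.
Proof.
move=> iS gS.
(* A canonical assignment of parity [b] on [S]: [b] at [i] and false elsewhere. *)
pose base b (x : cube n) := mix S (upd [ffun=> false] i b) x.
have par_base b x : par S (base b x) = b.
  rewrite -[RHS]addbF (_ : false = par (S :\ i) [ffun=> false]); last first.
    by rewrite /par big1 // => j _; rewrite ffunE.
  rewrite -par_upd //; apply: par_depends_only => j jS.
  by rewrite ffunE jS.
have restrict_base b x :
    restrict1 g i b x = g (base (b (+) par (S :\ i) x) x).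
  rewrite restrict1E; apply: gS; last by rewrite par_upd // par_base.
  move=> j; rewrite inE => jS; rewrite !ffunE (negPf jS).
  by case: eqVneq => // ji; rewrite -ji (negPf jS) in iS.
pose d x : R := (g (base true x))%:R - (g (base false x))%:R.
have -> : mean D (restrict1 g i true) - mean D (restrict1 g i false) =
    Expect D (fun x => (-1) ^+ par (S :\ i) x * d x).
  rewrite /mean -ExpectB; apply: eq_Expect => x; rewrite !restrict_base /d.
  by case: (par _ x); rewrite /= ?expr1 ?expr0; ring.
rewrite (@Expect_indep _ _ _ prodD S); first last.
- move=> x y e; rewrite /d; congr ((nat_of_bool (g _))%:R - (nat_of_bool (g _))%:R);
    by apply/ffunP => j; rewrite !ffunE; case: ifP => // jS; apply: e; rewrite inE jS.
- move=> x y e; congr (_ ^+ _); congr nat_of_bool.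
  by apply: par_depends_only => j; rewrite in_setD1 => /andP[_ /e].
rewrite normrM -[leRHS]mulr1; apply: ler_pM => //.
  by rewrite [#|S|](cardsD1 i) iS; exact: par_bias.
by apply: ler_norm_Expect => x; rewrite /d;
  case: (g _); case: (g _); rewrite ?subrr ?subr0 ?sub0r ?normrN ?normr0 ?normr1.
Qed.

Lemma balanced_Prob i : delta <= Prob D (fun x => x i) <= 1 - delta.
Proof. by rewrite ProbE; case: balD => _; apply. Qed.

Lemma purity_gainE (G : R -> R) f i :
  let p := Prob D (fun x => x i) in
  let u := mean D (restrict1 f i true) in
  let v := mean D (restrict1 f i false) in
  purity_gain G D f i = G (p * u + (1 - p) * v) - p * G u - (1 - p) * G v.
Proof. by rewrite /purity_gain (mean_restrict1 prodD f i). Qed.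

End Balanced.

(** * The target functions *)

(* Block [None] is the junta; the parities of the blocks [Some (inl _)] decide
   whether the junta is overridden, and those of the blocks [Some (inr _)] are
   the address of the [y]-variable that overrides it. *)
Definition coord (w k m : nat) : finType :=
  (option ('I_w + 'I_k) * 'I_m + {ffun 'I_k -> bool})%type.

Definition nvars w k m : nat := #|coord w k m|.

Section Construction.
Variables w k m : nat.
Local Notation n := (nvars w k m).
Local Notation address := {ffun 'I_k -> bool}.

Definition block (t : option ('I_w + 'I_k)) : {set 'I_n} :=
  [set i | if enum_val i is inl sj then sj.1 == t else false].

Definition yvar (a : address) : 'I_n := enum_rank (inr a : coord w k m).

Definition yvars : {set 'I_n} := [set yvar a | a : address].

Definition selected (x : cube n) : bool :=
  [forall a, par (block (Some (inl a))) x].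

Definition selected_address (x : cube n) : address :=
  [ffun j => par (block (Some (inr j))) x].

Definition target : boolfun n := fun x =>
  if selected x then x (yvar (selected_address x)) else par (block None) x.

Definition block_value (a : address) (t : 'I_w + 'I_k) : bool :=
  if t is inr j then a j else true.

Lemma yvar_inj : injective yvar.
Proof. by move=> a b /enum_rank_inj[]. Qed.

Lemma card_block t : #|block t| = m.
Proof.
rewrite -[RHS]card_ord.
rewrite -(card_imset _
  (_ : injective (fun j : 'I_m => enum_rank (inl (t, j) : coord w k m)))).
  apply: eq_card => i; rewrite inE; apply/idP/imsetP.
    case E: (enum_val i) => [[s j]|//] /= /eqP st; exists j => //.
    by rewrite -st -E enum_valK.
  by move=> [j _ ->]; rewrite enum_rankK /=.
by move=> j j' /enum_rank_inj[].
Qed.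

Lemma block_disjoint s t : s != t -> [disjoint block s & block t].
Proof.
move=> st; rewrite -setI_eq0; apply/eqP/setP => i; rewrite !inE.
by case: (enum_val i) => [[u j]|//] /=; case: eqVneq => // ->; exact: negbTE.
Qed.

Lemma yvar_notin_block a t : yvar a \notin block t.
Proof. by rewrite inE enum_rankK. Qed.

Lemma yvars_or_block i : i \in yvars \/ exists t, i \in block t.
Proof.
case E: (enum_val i) => [[t j]|a]; [right; exists t | left].
  by rewrite inE E /=.
by apply/imsetP; exists a => //; rewrite /yvar -E enum_valK.
Qed.

Lemma yvars_notin_block i t : i \in yvars -> i \notin block t.
Proof. by case/imsetP => a _ ->; exact: yvar_notin_block. Qed.

(** Phrases the selection of [a] as one condition per block, so that its probability becomes a
    product. *)
Lemma selectedE a x : selected x && (selected_address x == a)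
  = [forall t, par (block (Some t)) x == block_value a t].
Proof.
apply/andP/forallP => [[/forallP sx /eqP <-] [i|j]|h] /=.
- exact/eqP/sx.
- by rewrite ffunE.
split; first by apply/forallP => i; exact/eqP/(h (inl i)).
by apply/eqP/ffunP => j; rewrite ffunE; exact/eqP/(h (inr j)).
Qed.

(** Constraints on y-variables leave all block parities unchanged. *)
Lemma restrict_targetE (pi : restriction n) x :
    (forall i, pi i -> i \in yvars) ->
  restrict_by target pi x =
    if selected x then overwrite pi x (yvar (selected_address x))
    else par (block None) x.
Proof.
move=> piY.
have par_pi t : par (block t) (overwrite pi x) = par (block t) x.
  apply: par_depends_only => i iB; rewrite ffunE.
  case E: (pi i) => [b|//]; have := piY i; rewrite E => /(_ isT).
  by move/(yvars_notin_block t); rewrite iB.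
rewrite /restrict_by /target.
have -> : selected (overwrite pi x) = selected x.
  by apply: eq_forallb => a; rewrite par_pi.
have -> : selected_address (overwrite pi x) = selected_address x.
  by apply/ffunP => j; rewrite !ffunE par_pi.
by rewrite par_pi.
Qed.

Lemma target_par x : target x != par (block None) x -> selected x.
Proof. by rewrite /target; case: ifP; rewrite ?eqxx. Qed.

(** * Impurity-based trees for the target function *)

Section Learning.
Variables (R : realType) (D : dist R n) (alpha L delta : R) (G : R -> R).
Hypotheses (delta0 : 0 < delta) (delta_le : delta <= 2^-1).
Hypothesis balD : balanced_product delta D.
Hypothesis bias_le : (1 - 2 * delta) ^+ m <= 3^-1.

Let prodD : product_dist D. Proof. by case: balD. Qed.

(** The deviation from 1/2 is at most half the bias, hence at most 1/6. *)
Lemma block_bias t b : 3^-1 <= Prob D (fun x => par (block t) x == b) <= 2 / 3.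
Proof.
have := mean_par balD (block t) b.
by rewrite card_block ler_norml; move: bias_le; lra.
Qed.

Lemma Prob_blocks (J : finType) (t : J -> option ('I_w + 'I_k)) (b : J -> bool) :
    injective t ->
  Prob D (fun x => [forall j, par (block (t j)) x == b j])
  = \prod_j Prob D (fun x => par (block (t j)) x == b j).
Proof.
move=> tI; rewrite ProbE.
have E x : ([forall j, par (block (t j)) x == b j])%:R
    = \prod_(j <- index_enum J) (par (block (t j)) x == b j)%:R :> R.
  have natb : {morph (fun c : bool => c%:R : R) : c d / c && d >-> c * d}.
    by move=> c d; rewrite -natrM mulnb.
  by rewrite -(big_morph _ natb (erefl (true%:R : R))) big_andE.
rewrite (eq_Expect D E) (@Expect_prod _ _ _ prodD _ _ (fun j => block (t j))).
- by apply: eq_bigr => j _; rewrite ProbE.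
- exact: index_enum_uniq.
- by move=> i j ij; apply: block_disjoint; rewrite inj_eq.
- by move=> j x y e; rewrite (par_depends_only e).
Qed.

Lemma Prob_selected : Prob D selected <= (2 / 3) ^+ w.
Proof.
have -> : Prob D selected
    = Prob D (fun x => [forall a : 'I_w, par (block (Some (inl a))) x == true]).
  rewrite !ProbE; apply: eq_Expect => x; congr (nat_of_bool _)%:R.
  by apply: eq_forallb => a; rewrite eqb_id.
rewrite Prob_blocks; last by move=> a b [].
rewrite -[X in _ ^+ X]card_ord -prodr_const; apply: ler_prod => a _.
by have := block_bias (Some (inl a)) true; lra.
Qed.

(** Fixing a free [yvar a] matters exactly when [a] is selected, and then the value is the fixed
    bit. The difference is thus the probability that [w + k] independent parities take prescribed
    values, each having probability at least 1/3. *)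
Lemma yvar_gap (pi : restriction n) a :
    (forall i, pi i -> i \in yvars) -> pi (yvar a) = None ->
  3^-1 ^+ (w + k) <= mean D (restrict1 (restrict_by target pi) (yvar a) true)
                     - mean D (restrict1 (restrict_by target pi) (yvar a) false).
Proof.
move=> piY pia.
have -> : mean D (restrict1 (restrict_by target pi) (yvar a) true)
    - mean D (restrict1 (restrict_by target pi) (yvar a) false)
    = Prob D (fun x => [forall t, par (block (Some t)) x == block_value a t]).
  rewrite ProbE /mean -ExpectB; apply: eq_Expect => x.
  rewrite -selectedE !restrict1E !restrict_targetE //.
  have par_x b t : par (block t) (upd x (yvar a) b) = par (block t) x.
    apply: par_depends_only => i iB; rewrite ffunE; case: eqVneq => // ia.
    by have := yvar_notin_block a t; rewrite -ia iB.
  have sel_x b : selected (upd x (yvar a) b) = selected x.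
    by apply: eq_forallb => c; rewrite par_x.
  have addr_x b : selected_address (upd x (yvar a) b) = selected_address x.
    by apply/ffunP => j; rewrite !ffunE par_x.
  rewrite !sel_x !addr_x !par_x; case: (selected x); last by rewrite subrr.
  rewrite !ffunE (inj_eq yvar_inj) /=.
  by case: eqVneq => [->|_]; rewrite ?pia ?subrr ?subr0.
rewrite Prob_blocks; last by move=> s t [].
rewrite (_ : (w + k)%N = #|{: 'I_w + 'I_k}|); last by rewrite card_sum !card_ord.
rewrite -prodr_const; apply: ler_prod => t _.
by have := block_bias (Some t) (block_value a t); rewrite invr_ge0; lra.
Qed.

(** The restricted target sees each block only through its parity; fixing [i] leaves [m.-1]
    variables to randomize it. *)
Lemma block_gap (pi : restriction n) i t :
    (forall i, pi i -> i \in yvars) -> i \in block t ->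
  `|mean D (restrict1 (restrict_by target pi) i true)
    - mean D (restrict1 (restrict_by target pi) i false)|
    <= (1 - 2 * delta) ^+ m.-1.
Proof.
move=> piY it; have := @restrict1_par_diff _ _ _ _ balD (restrict_by target pi) _ _ it.
rewrite card_block; apply => x y exy ep.
have par_xy s : par (block s) x = par (block s) y.
  have [->//|st] := eqVneq s t.
  apply: par_depends_only => j js; apply: exy; rewrite inE.
  apply: contraL js => jt.
  by move/pred0P/(_ j): (block_disjoint st); rewrite /= jt andbT => ->.
rewrite !restrict_targetE //.
have -> : selected x = selected y by apply: eq_forallb => a; rewrite par_xy.
have -> : selected_address x = selected_address y.
  by apply/ffunP => j; rewrite !ffunE par_xy.
by rewrite par_xy !ffunE exy // inE yvar_notin_block.
Qed.

Hypotheses (alpha0 : 0 < alpha) (Gab : ab_impurity alpha L G).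
Hypothesis gap_lt : L * ((1 - 2 * delta) ^+ m.-1) ^+ 2
  < alpha * delta ^+ 3 / 4 * (3^-1 ^+ (w + k)) ^+ 2.

(** By [gap_lt], the upper bound on the gain of any block variable is below the lower bound on the
    gain of the free [yvar a]. *)
Lemma max_gain_yvars (pi : restriction n) a i :
    (forall i, pi i -> i \in yvars) -> pi (yvar a) = None ->
    (forall j, purity_gain G D (restrict_by target pi) j
               <= purity_gain G D (restrict_by target pi) i) ->
  i \in yvars.
Proof.
move=> piY pia imax; have [//|[t it]] := yvars_or_block i.
have L0 : 0 <= L.
  have [_ [G1 [G2 [_ _ /(_ 2^-1)]]]] := Gab.
  by move: alpha0; lra.
have := imax (yvar a).
rewrite !(purity_gainE balD).
set pa := Prob D _; set ua := mean D _; set va := mean D _.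
set p := Prob D _; set u := mean D _; set v := mean D _.
have pa_bal : delta <= pa <= 1 - delta by exact: balanced_Prob.
have p01 : 0 <= p <= 1 by exact: Prob01.
have := impurity_gap_ge alpha0 Gab delta0 pa_bal (mean01 _ _ : 0 <= ua <= 1)
  (mean01 _ _ : 0 <= va <= 1).
have := impurity_gap_le alpha0 Gab p01 (mean01 _ _ : 0 <= u <= 1)
  (mean01 _ _ : 0 <= v <= 1).
have hy : (3^-1 ^+ (w + k)) ^+ 2 <= (ua - va) ^+ 2.
  have := yvar_gap piY pia; rewrite -/ua -/va => h.
  have h0 : 0 <= 3^-1 ^+ (w + k) :> R by rewrite exprn_ge0 ?invr_ge0.
  by rewrite lerXn2r ?nnegrE // (le_trans h0 h).
have hb : (u - v) ^+ 2 <= ((1 - 2 * delta) ^+ m.-1) ^+ 2.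
  rewrite -[X in X <= _]real_normK ?num_real //.
  rewrite lerXn2r ?nnegrE //; last exact: block_gap piY it.
  by rewrite exprn_ge0 //; move: delta_le; lra.
have hy' : alpha * delta ^+ 3 / 4 * (3^-1 ^+ (w + k)) ^+ 2
    <= alpha * delta ^+ 3 / 4 * (ua - va) ^+ 2.
  by rewrite ler_wpM2l // divr_ge0 // mulr_ge0 ?exprn_ge0 // ltW.
have hb' : L * (u - v) ^+ 2 <= L * ((1 - 2 * delta) ^+ m.-1) ^+ 2.
  by rewrite ler_wpM2l.
move=> h1 h2 h3; have := le_trans hy' (le_trans h2 (le_trans h3 (le_trans h1 hb'))).
by rewrite leNgt gap_lt.
Qed.

(** Induction on the tree: so far only y-variables are constrained, and their number plus the
    remaining depth is at most [2 ^ k]. *)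
Lemma shallow_tree_yvars (T : dtree n) (pi : restriction n) :
    (forall i, pi i -> i \in yvars) ->
    (#|[set i | isSome (pi i)]| + tree_depth T <= 2 ^ k)%N ->
    (forall v, v \in internal_nodes pi T -> forall j,
       purity_gain G D (restrict_by target v.1) j
         <= purity_gain G D (restrict_by target v.1) v.2) ->
  depends_only yvars (tree_eval T).
Proof.
elim: T pi => [b|i T0 IH0 T1 IH1] pi piY /= sz vmax; first by [].
(* An internal node has depth at least 1, so fewer than [2 ^ k] variables are constrained here. *)
have [a pia] : exists a, pi (yvar a) = None.
  apply: contrapT => hn.
  have : (#|yvars| <= #|[set i | isSome (pi i)]|)%N.
    apply/subset_leq_card/fintype.subsetP => _ /imsetP[a _ ->]; rewrite inE.
    by case E: (pi (yvar a)) => //; case: hn; exists a.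
  rewrite card_imset; last exact: yvar_inj.
  rewrite card_ffun card_bool card_ord => h.
  have := leq_trans (leq_add h (leqnn _)) sz.
  by rewrite addnS ltnNge leq_addr.
have iY : i \in yvars.
  by apply: (max_gain_yvars piY pia); apply: (vmax (pi, i)); rewrite inE eqxx.
have addY b j : add_constraint pi i b j -> j \in yvars.
  by rewrite ffunE; case: ifP => [/andP[/eqP->]|_ /piY].
(* A query adds at most one constraint, and none if it repeats an earlier one. *)
have szb b (T' : dtree n) : (tree_depth T' <= maxn (tree_depth T0) (tree_depth T1))%N ->
    (#|[set j | isSome (add_constraint pi i b j)]| + tree_depth T' <= 2 ^ k)%N.
  move=> hT; apply: leq_trans sz.
  apply: (@leq_trans (#|i |: [set j | isSome (pi j)]| + tree_depth T')).
    rewrite leq_add2r; apply/subset_leq_card/fintype.subsetP => j.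
    by rewrite !inE ffunE; case: eqVneq.
  by rewrite addnS -addSn leq_add // cardsU1 -add1n leq_add2r leq_b1.
have d0 := IH0 _ (addY false) (szb false T0 (leq_maxl _ _)).
have d1 := IH1 _ (addY true) (szb true T1 (leq_maxr _ _)).
move=> x y exy; rewrite exy //.
rewrite (d0 _ x y exy) ?(d1 _ x y exy) // => v hv; apply: vmax;
  by rewrite inE mem_cat hv ?orbT.
Qed.

(** The tree is independent of the parity of block [None], whose bias is at most 1/3, so they
    disagree with probability at least 1/2 - 1/6. The target differs from that parity only on
    [selected]. *)
Lemma yvars_tree_error (T : dtree n) : depends_only yvars (tree_eval T) ->
  3^-1 - (2 / 3) ^+ w <= tree_error D T target.
Proof.
move=> TY; rewrite /tree_error.
have h1 : 3^-1 <= Prob D (fun x => tree_eval T x != par (block None) x).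
  have -> : Prob D (fun x => tree_eval T x != par (block None) x) =
      2^-1 - 2^-1 * (Expect D (fun x => (-1) ^+ tree_eval T x)
                     * Expect D (fun x => (-1) ^+ par (block None) x)).
    rewrite -(@Expect_indep _ _ _ prodD yvars).
    - rewrite -[X in _ = X - _](Expect_cst D) -ExpectZ -ExpectB ProbE.
      apply: eq_Expect => x.
      by case: (tree_eval T x); case: (par _ x); rewrite /= ?expr1 ?expr0; field.
    - by move=> x y e; rewrite (TY x y e).
    - move=> x y e; congr (_ ^+ _); congr nat_of_bool; apply: par_depends_only => i iB.
      by apply: e; rewrite inE; apply: contraL iB; exact: yvars_notin_block.
  have : `|Expect D (fun x => (-1) ^+ tree_eval T x)
           * Expect D (fun x => (-1) ^+ par (block None) x)| <= 1 * 3^-1.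
    rewrite normrM; apply: ler_pM => //.
      by apply: ler_norm_Expect => x; rewrite normr_sign.
    by apply: (le_trans (par_bias balD _)); rewrite card_block.
  by rewrite ler_norml; lra.
have := Prob_selected.
suff : Prob D (fun x => tree_eval T x != par (block None) x)
    <= Prob D (fun x => tree_eval T x != target x) + Prob D selected.
  by lra.
rewrite !ProbE -ExpectD; apply: ler_Expect => x; rewrite /target.
case: (selected x); last by rewrite addr0.
by case: (_ != par _ _); rewrite ?addr_ge0 // lerDr.
Qed.

End Learning.

End Construction.

(** * Choice of the parameters *)

Lemma expr_eventually_lt (R : realType) (x e : R) : 0 <= x < 1 -> 0 < e ->
  exists K, forall k, (K <= k)%N -> x ^+ k < e.
Proof.
move=> /andP[x0 x1] e0.
have xn : `|x| < 1 by rewrite ger0_norm.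
have /cvgrPdist_lt /(_ _ e0) [K _ hK] := cvg_expr xn.
exists K => k /hK /=.
by rewrite sub0r normrN ger0_norm // exprn_ge0.
Qed.

Lemma ler_bernoulli (R : realFieldType) (x : R) (s : nat) : 0 <= x ->
  1 + x *+ s <= (1 + x) ^+ s.
Proof.
move=> x0; elim: s => [|s IH]; first by rewrite mulr0n addr0 expr0.
have x1 : 0 <= 1 + x by rewrite addr_ge0.
rewrite exprSr; apply: le_trans (ler_wpM2r x1 IH).
have := mulr_ge0 (mulrn_wge0 s x0) x0.
by rewrite mulrSr; set y := x *+ s; lra.
Qed.

(** Bernoulli gives [(1 + 2 * delta) ^+ s >= 3], and [(1 - 2 * delta) * (1 + 2 * delta) <= 1]. *)
Lemma parity_bias_le_third (R : realFieldType) (delta : R) (s : nat) :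
  0 <= delta -> delta <= 2^-1 -> 1 <= s%:R * delta -> (1 - 2 * delta) ^+ s <= 3^-1.
Proof.
move=> d0 d1 sd.
have h : 3 <= (1 + 2 * delta) ^+ s.
  apply: le_trans (ler_bernoulli s _); last by rewrite mulr_ge0.
  by rewrite -mulr_natr; move: sd; lra.
have h1 : (1 - 2 * delta) ^+ s * (1 + 2 * delta) ^+ s <= 1.
  rewrite -exprMn exprn_ile1 //.
    by rewrite mulr_ge0; lra.
  by have := sqr_ge0 delta; lra.
have h2 : 0 <= (1 - 2 * delta) ^+ s by rewrite exprn_ge0; lra.
have h3 := ler_wpM2l h2 h.
lra.
Qed.

Theorem theorem5 (R : realType) :
  exists C c1 c2 : R, [/\ 0 < C, 0 < c1, 0 < c2 &
    forall alpha L delta eps : R,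
      0 < alpha -> alpha <= L ->
      0 < delta -> delta <= 2^-1 ->
      0 < eps -> eps <= 1 ->
      exists (n : nat -> nat) (f : forall k : nat, boolfun (n k)) (K : nat),
        forall k : nat, (K <= k)%N ->
        forall D : dist R (n k), balanced_product delta D ->
          (exists (r : nat) (g : boolfun (n k)),
             [/\ r%:R <= C * k%:R / delta, junta r g & eps_close eps D (f k) g])
          /\
          (forall G : R -> R, ab_impurity alpha L G ->
           forall A : learner R, impurity_based G A ->
             c1 * eps * 2 ^+ k <= (tree_depth (A (n k) (f k) D))%:R
             \/ c2 <= tree_error D (A (n k) (f k) D) (f k))].
Proof.
(* The 6 comes from blocks of size [3 * s * k] with [s * delta <= 2]; 1/5 is below 1/3 - 1/8, the
   error left when [(2 / 3) ^+ w < eps / 8]. *)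
exists 6, 1, (1 / 5); split; [lra|lra|lra|].
move=> alpha L delta eps a0 aL d0 d2 e0 e1.
have L0 : 0 < L by exact: lt_le_trans aL.
have [s sd sd2] : exists2 s : nat, 1 <= s%:R * delta & s%:R * delta <= 2.
  exists (Num.truncn delta^-1).+1.
    by rewrite -ler_pdivrMr // mul1r ltW // truncnS_gt.
  rewrite -natr1 mulrDl mul1r.
  have : (Num.truncn delta^-1)%:R * delta <= 1.
    by rewrite -ler_pdivlMr // mul1r truncn_le // invr_ge0 ltW.
  lra.
have s0 : (0 < s)%N by case: s sd {sd2} => //; rewrite mul0r ler10.
have bias_s := parity_bias_le_third (ltW d0) d2 sd.
have b0 : 0 <= 1 - 2 * delta by lra.
have b1 : 1 - 2 * delta <= 1 by lra.
(* This choice serves both the closeness to the junta and, as [eps <= 1], the error bound. *)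
have [w hw] : exists w, (2 / 3) ^+ w < eps / 8.
  have x01 : 0 <= (2 / 3 : R) < 1 by lra.
  have [K hK] := expr_eventually_lt x01 (ltac:(lra) : 0 < eps / 8).
  by exists K; exact: hK.
have w9 : 0 < 9^-1 ^+ w :> R by rewrite exprn_gt0 // invr_gt0.
(* The squared bias decays like [9^-1 ^+ (2 * k)] and the squared y-gap like [9^-1 ^+ (w + k)]; a
   spare factor [9^-1 ^+ k] absorbs the constants. *)
have [K hK] : exists K, forall k, (K <= k)%N ->
    9^-1 ^+ k < alpha * delta ^+ 3 / 4 * 9^-1 ^+ w / L.
  apply: expr_eventually_lt; first by lra.
  by rewrite !(divr_gt0, mulr_gt0, exprn_gt0).
(* Two of the three copies of [s * k] bring the bias down to [9^-1 ^+ k]; the third covers the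
   variable lost in [m.-1]. *)
pose m k := (3 * s * k)%N.
(* The successor forces [k > 0], so that [m k] is at least [s]. *)
exists (fun k => nvars w k (m k)), (fun k => @target w k (m k)), K.+1 => k Kk D balD.
have k0 : (0 < k)%N by exact: leq_ltn_trans Kk.
have bias_le : (1 - 2 * delta) ^+ m k <= 3^-1.
  apply: le_trans bias_s; apply: ler_wiXn2l => //.
  by rewrite /m mulnAC -[leqLHS]mul1n leq_mul2r muln_gt0 k0 orbT.
split.
  exists (m k), (par (@block w k (m k) None)); split.
  - rewrite ler_pdivlMr // /m !natrM.
    have : (s%:R * delta) * k%:R <= 2 * k%:R by rewrite ler_wpM2r.
    by lra.
  - by rewrite -[X in junta X](@card_block w k (m k) None); exact: par_junta.
  - apply: (@le_trans _ _ (Prob D (@selected w k (m k)))).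
      rewrite !ProbE; apply: ler_Expect => x.
      have := @target_par w k (m k) x.
      by case: (_ != _) => [/(_ isT)->|_]; rewrite ?ler0n.
    by apply: (le_trans (Prob_selected balD bias_le)); lra.
move=> G Gab A GA; set T := A _ _ _.
have [?|depth_lt] := lerP (1 * eps * 2 ^+ k) (tree_depth T)%:R; [by left | right].
have gap_lt : L * ((1 - 2 * delta) ^+ (m k).-1) ^+ 2
    < alpha * delta ^+ 3 / 4 * (3^-1 ^+ (w + k)) ^+ 2.
  have hb : (1 - 2 * delta) ^+ (m k).-1 <= 9^-1 ^+ k.
    apply: (@le_trans _ _ ((1 - 2 * delta) ^+ (s * (2 * k)))).
      apply: ler_wiXn2l => //.
      have sk0 : (0 < s * k)%N by rewrite muln_gt0 s0 k0.
      by rewrite /m mulnCA -mulnA -ltnS prednK ?muln_gt0 ?s0 ?k0 // ltn_pmul2r.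
    rewrite exprM (_ : 9^-1 = 3^-1 ^+ 2); last by field.
    by rewrite -[leRHS]exprM lerXn2r ?nnegrE ?exprn_ge0 ?invr_ge0.
  have hb2 : ((1 - 2 * delta) ^+ (m k).-1) ^+ 2 <= 9^-1 ^+ k * 9^-1 ^+ k.
    by rewrite expr2 ler_pM ?exprn_ge0.
  apply: (le_lt_trans (ler_wpM2l (ltW L0) hb2)).
  have -> : (3^-1 ^+ (w + k)) ^+ 2 = 9^-1 ^+ w * 9^-1 ^+ k :> R.
    by rewrite exprAC (_ : 3^-1 ^+ 2 = 9^-1) ?exprD //; field.
  rewrite mulrA mulrA ltr_pM2r ?exprn_gt0 ?invr_gt0 //.
  by rewrite mulrC -ltr_pdivlMr // hK // ltnW.
have depth_le : (tree_depth T <= 2 ^ k)%N.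
  rewrite -(ler_nat R) natrX; apply: (le_trans (ltW depth_lt)).
  by rewrite mul1r ler_piMl // exprn_ge0.
have TY : depends_only (yvars w k (m k)) (tree_eval T).
  apply: (shallow_tree_yvars d0 d2 balD bias_le a0 Gab gap_lt (pi := no_constraint _)).
  - by move=> i; rewrite ffunE.
  - rewrite (_ : [set i | _] = finset.set0) ?cards0 //.
    by apply/setP => i; rewrite !inE ffunE.
  - exact: GA.
have := yvars_tree_error balD bias_le TY.
lra.
Qed.
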